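(* Consider the adaptive system $$\dot x=A_px+bu,\qquad \dot x_m=A_mx_m+br+\ell(x-x_m),$$ $$u=\theta^Tx+r,\qquad \dot\theta=\mathrm{Proj}_\Gamma\left(\theta,-xe^TPb,f\right),\qquad e=x-x_m,$$ with all objects as in the context (in particular the matching condition $A_m=A_p+b\theta^{*T}$ and $\|\theta^*\|\le\theta^*_{max}$ hold), and with $\|\theta(0)\|\le\theta_{\max}$. Let $x_m^o$ be the state of the open-loop reference model $\dot x_m^o=A_mx_m^o+br$ with $x_m^o(0)=x_m(0)$, and let $e^o=x-x_m^o$. Let $\rho=\gamma/(\sigma+\ell)$, $\tilde\theta=\theta-\theta^*$ and $\nu(\rho)=m^2\|e(0)\|^2+\frac1\rho\|\tilde\theta(0)\|^2$. Then for all $t\ge0$ $$\|e^o(t)\|\le\|e(t)\|+\sqrt{\frac{\ell}{\sigma}}\;m\,\sqrt{\nu(\rho)} .$$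
   Context: $\|\cdot\|$ is the Euclidean norm (induced norm for matrices). $A_p\in\mathbb R^{n\times n}$, $b\in\mathbb R^n$, $A_m\in\mathbb R^{n\times n}$ is Hurwitz, $r:[0,\infty)\to\mathbb R$ is bounded, $\ell\ge0$, $\gamma>0$, $\Gamma=\gamma I_{n\times n}$. $\theta^*\in\mathbb R^n$ satisfies $A_m=A_p+b\theta^{*T}$ and $\|\theta^*\|\le\theta^*_{max}$, with $\theta^*_{max}>0$ known. $\bar A_m=A_m-\ell I_{n\times n}$ and $P=P^T>0$ solves $\bar A_m^TP+P\bar A_m=-I_{n\times n}$. Constants: $\sigma=-\max_i\mathrm{Re}\,\lambda_i(A_m)$, $a=\|A_m\|$, $m=(1+4a/\sigma)^{n-1}$. Projection: with $\vartheta=\theta^*_{max}$ and a design constant $\varepsilon>0$, $f(\theta)=\dfrac{\|\theta\|^2-\vartheta^2}{2\varepsilon\vartheta+\varepsilon^2}$, $\theta_{\max}=\vartheta+\varepsilon$, and $$\mathrm{Proj}_\Gamma(\theta,y,f)=\begin{cases}\Gamma y-\Gamma\dfrac{\nabla f(\theta)\nabla f(\theta)^T}{\nabla f(\theta)^T\Gamma\nabla f(\theta)}\Gamma y\,f(\theta)&\text{if }f(\theta)>0\text{ and }y^T\Gamma\nabla f(\theta)>0,\\ \Gamma y&\text{otherwise.}\end{cases}$$ *)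

(* Defs.v *)
From HB Require Import structures.
From mathcomp Require Import all_boot all_order all_algebra.
From mathcomp Require Import all_classical all_reals all_analysis.
From mathcomp Require Import complex.

Set Implicit Arguments.
Unset Strict Implicit.
Unset Printing Implicit Defensive.

Import Order.TTheory GRing.Theory Num.Theory.
Import numFieldNormedType.Exports.

Local Open Scope classical_set_scope.
Local Open Scope ring_scope.

(* MathComp-Analysis equips matrices with the max norm `|A|; the Euclidean norm
   and the matrix norm it induces are therefore defined here. *)
Definition enorm (R : realType) (n : nat) (v : 'cV[R]_n) : R :=
  Num.sqrt (\sum_(i < n) v i 0 ^+ 2).

Definition opnorm (R : realType) (n : nat) (A : 'M[R]_n) : R :=
  sup [set enorm (A *m v) | v in [set v : 'cV[R]_n | enorm v <= 1]].

Definition spectrum (R : realType) (n : nat) (A : 'M[R]_n) : set R[i] :=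
  [set l : R[i] | eigenvalue (map_mx (real_complex R) A) l].

Definition hurwitz (R : realType) (n : nat) (A : 'M[R]_n) : Prop :=
  forall l : R[i], spectrum A l -> complex.Re l < 0.

(* - max_i Re (lambda_i A): for 0 < n the spectrum is finite and nonempty, so
   that the sup is a max. *)
Definition stability_margin (R : realType) (n : nat) (A : 'M[R]_n) : R :=
  - sup [set complex.Re l | l in spectrum A].

Definition overshoot (R : realType) (n : nat) (A : 'M[R]_n) : R :=
  (1 + 4 * opnorm A / stability_margin A) ^+ n.-1.

Definition sym_posdef (R : realType) (n : nat) (P : 'M[R]_n) : Prop :=
  P = P^T /\ forall v : 'cV[R]_n, v != 0 -> 0 < (v^T *m P *m v) 0 0.

Definition grad (R : realType) (n : nat) (f : 'cV[R]_n -> R) (v : 'cV[R]_n) :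
    'cV[R]_n :=
  \col_(i < n) 'D_(delta_mx i 0) f v.

Definition proj_fun (R : realType) (n : nat) (vartheta eps : R)
    (th : 'cV[R]_n) : R :=
  (enorm th ^+ 2 - vartheta ^+ 2) / (2 * eps * vartheta + eps ^+ 2).

Definition Proj (R : realType) (n : nat) (Gamma : 'M[R]_n)
    (th y : 'cV[R]_n) (f : 'cV[R]_n -> R) : 'cV[R]_n :=
  let g := grad f th in
  if (0 < f th) && (0 < (y^T *m Gamma *m g) 0 0) then
    Gamma *m y -
      f th *: (Gamma *m (((g^T *m Gamma *m g) 0 0)^-1 *: (g *m g^T))
                 *m Gamma *m y)
  else Gamma *m y.

(* Absolute continuity on every [0, T]; the intervals [u k, v k] do not
   overlap. *)
Definition locally_abs_continuous (R : realType) (n : nat)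
    (x : R -> 'cV[R]_n) : Prop :=
  forall T eps : R, 0 < T -> 0 < eps ->
  exists2 delta : R, 0 < delta &
    forall (m : nat) (u v : 'I_m -> R),
      (forall k, 0 <= u k /\ u k <= v k /\ v k <= T) ->
      (forall k l, k != l -> v k <= u l \/ v l <= u k) ->
      \sum_(k < m) (v k - u k) < delta ->
      \sum_(k < m) enorm (x (v k) - x (u k)) < eps.

(* x is a solution on [0, +oo) of x'(t) = F t in the sense of Caratheodory:
   the reference input is only assumed bounded, so F need not be
   continuous in t.  An everywhere differentiable solution is a special case
   as soon as F is bounded on every [0, T], because it is then Lipschitz
   there. Values at t < 0 are junk. *)
Definition solves_ode (R : realType) (n : nat) (x F : R -> 'cV[R]_n) : Prop :=
  locally_abs_continuous x /\
  {ae @lebesgue_measure R, forall t : R, 0 < t -> is_derive t (1 : R) x (F t)}.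

(* Main.v *)
(** Let D = xm - xmo, so that eo = e + D and D' = Am D + ell e.  A unitary
    triangularization of Am and geometric weights give a quadratic form Q with
    |v|^2 <= v^T Q v <= m^2 |v|^2 and 2 v^T Q Am v <= - sigma v^T Q v.  The same
    Q is a Lyapunov form for Am - ell I with rate sigma + 2 ell, whence
    (sigma + 2 ell) P <= Q.  With V = e^T P e + |theta - theta_star|^2 / gamma,
    V' <= - |e|^2 because the projection only helps, hence
    Z = D^T Q D + (ell^2 m^2 / sigma) V satisfies Z' <= 0 almost everywhere.  As Z
    is locally absolutely continuous, |D t|^2 <= Z t <= Z 0, and D 0 = 0. *)

Require Import Defs.
From HB Require Import structures.
From mathcomp Require Import all_boot all_order all_algebra.
From mathcomp Require Import all_classical all_reals all_analysis.
From mathcomp Require Import complex spectral zify ring lra.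

Import Order.TTheory GRing.Theory Num.Theory.
Import numFieldNormedType.Exports.
Import Normc.

Local Open Scope classical_set_scope.
Local Open Scope ring_scope.

(** * Bilinear forms, the Euclidean norm and the norm it induces on matrices *)

Section EuclideanNorm.
Context {R : realType} {n : nat}.
Implicit Types (u v w : 'cV[R]_n) (M N A : 'M[R]_n).

(** The form Q replaces the exponential estimate on exp(A t): its two bounds carry the constant m
    and its dissipation inequality the decay rate, so no matrix exponential and no integral formula
    for P occurs. Comparing P with Q removes P from the final estimate: V at time 0 contains e^T P
    e, which must be bounded by m^2 |e|^2 with a factor that compensates for ell. Since r is only
    bounded, the differential equations hold only almost everywhere, and Z' <= 0 almost everywhere
    does not by itself make Z nonincreasing: the Cantor function has derivative 0 almost everywhere
    and still increases. Absolute continuity excludes this. Monotonicity is derived directly from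
    its epsilon-delta form, by real induction along a cover of the exceptional null set by an open
    set of small measure, without integrating Z'. *)

Definition form M u v : R := (u^T *m M *m v) 0 0.

Lemma formE M u v : form M u v = \sum_i \sum_j u i 0 * M i j * v j 0.
Proof.
rewrite /form mxE exchange_big; apply: eq_bigr => j _.
by rewrite mxE mulr_suml; apply: eq_bigr => i _; rewrite !mxE.
Qed.

Lemma formDl M u v w : form M (u + v) w = form M u w + form M v w.
Proof. by rewrite /form linearD /= !mulmxDl mxE. Qed.

Lemma formDr M u v w : form M w (u + v) = form M w u + form M w v.
Proof. by rewrite /form mulmxDr mxE. Qed.

Lemma formZl M c u v : form M (c *: u) v = c * form M u v.
Proof. by rewrite /form linearZ /= -!scalemxAl mxE. Qed.

Lemma formZr M c u v : form M u (c *: v) = c * form M u v.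
Proof. by rewrite /form -scalemxAr mxE. Qed.

Lemma formNl M u v : form M (- u) v = - form M u v.
Proof. by rewrite -scaleN1r formZl mulN1r. Qed.

Lemma formNr M u v : form M u (- v) = - form M u v.
Proof. by rewrite -scaleN1r formZr mulN1r. Qed.

Lemma formDm M N u v : form (M + N) u v = form M u v + form N u v.
Proof. by rewrite /form mulmxDr mulmxDl mxE. Qed.

Lemma formZm c M u v : form (c *: M) u v = c * form M u v.
Proof. by rewrite /form -scalemxAr -scalemxAl mxE. Qed.

Lemma formNm M u v : form (- M) u v = - form M u v.
Proof. by rewrite -scaleN1r formZm mulN1r. Qed.

Lemma formMr M A u v : form (M *m A) u v = form M u (A *m v).
Proof. by rewrite /form !mulmxA. Qed.

Lemma formMl M A u v : form (A^T *m M) u v = form M (A *m u) v.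
Proof. by rewrite /form trmx_mul !mulmxA. Qed.

Lemma formT M u v : form M^T u v = form M v u.
Proof.
rewrite /form -[LHS](mxE trmx_key (fun i j => (u^T *m M^T *m v) j i)).
by rewrite -/(trmx _) !trmx_mul !trmxK mulmxA.
Qed.

Lemma form_sym M u v : M^T = M -> form M u v = form M v u.
Proof. by move=> {1}<-; rewrite formT. Qed.

Lemma form1E u v : form 1%:M u v = \sum_i u i 0 * v i 0.
Proof.
by rewrite /form mulmx1 mxE; apply: eq_bigr => i _; rewrite mxE.
Qed.

Lemma enorm_sq v : enorm v ^+ 2 = form 1%:M v v.
Proof.
rewrite form1E /enorm sqr_sqrtr; last by apply: sumr_ge0 => i _; exact: sqr_ge0.
by apply: eq_bigr => i _; rewrite expr2.
Qed.

Lemma enorm_ge0 v : 0 <= enorm v.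
Proof. exact: sqrtr_ge0. Qed.

Lemma enorm_le_sqr v c : 0 <= c -> enorm v ^+ 2 <= c ^+ 2 -> enorm v <= c.
Proof. by move=> c0; rewrite ler_sqr// nnegrE enorm_ge0. Qed.

Lemma enormZ c v : enorm (c *: v) = `|c| * enorm v.
Proof.
apply/eqP; rewrite -(@eqrXn2 _ 2)// ?mulr_ge0 ?enorm_ge0//.
by rewrite exprMn !enorm_sq formZl formZr real_normK ?num_real// expr2 mulrA.
Qed.

Lemma enorm_entry v i : `|v i 0| <= enorm v.
Proof.
rewrite -sqrtr_sqr ler_wsqrtr//.
by rewrite (bigD1 i)//= lerDl sumr_ge0// => j _; exact: sqr_ge0.
Qed.

Lemma enorm_eq0 v : (enorm v == 0) = (v == 0).
Proof.
apply/eqP/eqP => [v0|->]; last first.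
  by rewrite /enorm big1 ?sqrtr0// => i _; rewrite mxE expr0n.
apply/colP => i; rewrite mxE; apply/eqP; rewrite -normr_le0 -v0.
exact: enorm_entry.
Qed.

Lemma enorm0 : enorm (0 : 'cV[R]_n) = 0.
Proof. by apply/eqP; rewrite enorm_eq0. Qed.

(* Nonnegativity of t |-> form M (u + t v) (u + t v) at t = - form M u v / form M v v. *)
Lemma form_CauchySchwarz M u v : M^T = M -> (forall w, 0 <= form M w w) ->
  form M u v ^+ 2 <= form M u u * form M v v.
Proof.
move=> symM psd.
have q t : 0 <= form M u u + 2 * t * form M u v + t ^+ 2 * form M v v.
  have := psd (u + t *: v).
  rewrite formDl !formDr !formZl !formZr (form_sym M v u symM); lra.
have [v0|vn0] := eqVneq (form M v v) 0.
  have [->|uv0] := eqVneq (form M u v) 0; first by rewrite expr0n mulr_ge0.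
  (* With [form M v v = 0] the polynomial is affine in t, and this t gives it the value -1. *)
  have := q (- (form M u u + 1) / (2 * form M u v)).
  rewrite v0 mulr0 addr0.
  have -> : 2 * (- (form M u u + 1) / (2 * form M u v)) * form M u v =
    - (form M u u + 1) by field.
  lra.
have vgt0 : 0 < form M v v by rewrite lt_def vn0 psd.
have := q (- form M u v / form M v v).
have -> : form M u u + 2 * (- form M u v / form M v v) * form M u v +
  (- form M u v / form M v v) ^+ 2 * form M v v =
  (form M u u * form M v v - form M u v ^+ 2) / form M v v by field.
by rewrite pmulr_lge0 ?invr_gt0// subr_ge0.
Qed.

Lemma form1_CauchySchwarz u v : form 1%:M u v <= enorm u * enorm v.
Proof.
apply: le_trans (ler_norm _) _.
rewrite -(@ler_sqr _ _ _) ?nnegrE ?mulr_ge0 ?enorm_ge0//.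
rewrite real_normK ?num_real// exprMn !enorm_sq.
apply: form_CauchySchwarz; first by rewrite trmx1.
by move=> w; rewrite -enorm_sq sqr_ge0.
Qed.

Lemma enormD u v : enorm (u + v) <= enorm u + enorm v.
Proof.
apply: enorm_le_sqr; first by rewrite addr_ge0 ?enorm_ge0.
rewrite enorm_sq formDl !formDr (form_sym _ v u) ?trmx1// sqrrD -!enorm_sq.
have := form1_CauchySchwarz u v; lra.
Qed.

Lemma form_bounded M : exists2 C, 0 < C & forall v, form M v v <= C * enorm v ^+ 2.
Proof.
exists (1 + \sum_i \sum_j `|M i j|).
  by rewrite ltr_pwDl// sumr_ge0// => i _; rewrite sumr_ge0.
move=> v; rewrite formE mulrDl mul1r -[leLHS]add0r lerD ?sqr_ge0//.
rewrite mulr_suml ler_sum// => i _; rewrite mulr_suml ler_sum// => j _.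
apply: le_trans (ler_norm _) _; rewrite !normrM mulrAC mulrC.
by rewrite ler_wpM2l// expr2 ler_pM ?enorm_entry.
Qed.

(** [sup] defaults to 0 on a set without upper bound; boundedness is what makes [opnorm] an actual
    supremum. *)
Lemma opnorm_has_ubound A :
  has_ubound [set enorm (A *m v) | v in [set v : 'cV[R]_n | enorm v <= 1]].
Proof.
have [C C0 hC] := form_bounded (A^T *m 1%:M *m A).
exists (Num.sqrt C) => _ [v /= v1 <-]; apply: enorm_le_sqr; first exact: sqrtr_ge0.
rewrite enorm_sq sqr_sqrtr ?(ltW C0)//.
rewrite -formMr -formMl mulmxA (le_trans (hC v))//.
rewrite ler_piMr ?(ltW C0)// expr_le1 ?enorm_ge0//.
Qed.

Lemma enorm_mulmx_le A v : enorm (A *m v) <= opnorm A * enorm v.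
Proof.
have [->|v0] := eqVneq v 0.
  by rewrite mulmx0 enorm0 mulr0.
have vgt0 : 0 < enorm v by rewrite lt_def enorm_eq0 v0 enorm_ge0.
rewrite -ler_pdivrMr//.
have -> : enorm (A *m v) / enorm v = enorm (A *m ((enorm v)^-1 *: v)).
  by rewrite -scalemxAr enormZ ger0_norm ?invr_ge0 ?enorm_ge0// mulrC.
apply: ub_le_sup; first exact: opnorm_has_ubound.
exists ((enorm v)^-1 *: v) => //=.
by rewrite enormZ ger0_norm ?invr_ge0 ?enorm_ge0// mulVf// gt_eqF.
Qed.

Lemma opnorm_ge0 A : 0 <= opnorm A.
Proof.
apply: le_trans (enorm_ge0 (A *m 0)) _; apply: ub_le_sup.
  exact: opnorm_has_ubound.
by exists 0 => //=; rewrite enorm0.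
Qed.

End EuclideanNorm.

(** * Complex vectors: Hermitian norm, unitary invariance, action of real matrices *)

Section Complexification.
Context {R : realType}.
Local Notation C := R[i].

Lemma Re_sum (I : Type) (s : seq I) (Q : pred I) (F : I -> C) :
  complex.Re (\sum_(i <- s | Q i) F i) = \sum_(i <- s | Q i) complex.Re (F i).
Proof. by apply: (big_morph (@complex.Re R)) => // -[a b] [c d]. Qed.

Lemma Im_sum (I : Type) (s : seq I) (Q : pred I) (F : I -> C) :
  complex.Im (\sum_(i <- s | Q i) F i) = \sum_(i <- s | Q i) complex.Im (F i).
Proof. by apply: (big_morph (@complex.Im R)) => // -[a b] [c d]. Qed.

Lemma normc_ge0 (z : C) : 0 <= normc z.
Proof. by case: z => a b; exact: sqrtr_ge0. Qed.

Lemma normc_sq (z : C) : normc z ^+ 2 = complex.Re z ^+ 2 + complex.Im z ^+ 2.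
Proof. by case: z => a b /=; rewrite sqr_sqrtr// addr_ge0 ?sqr_ge0. Qed.

Lemma normc_conj (z : C) : normc (conjc z) = normc z.
Proof. by case: z => a b /=; rewrite sqrrN. Qed.

Lemma Re_le_normc (z : C) : complex.Re z <= normc z.
Proof.
apply: le_trans (ler_norm _) _; rewrite -ler_sqr ?nnegrE ?normc_ge0//.
by rewrite real_normK ?num_real// normc_sq lerDl sqr_ge0.
Qed.

Definition cnorm2 {n : nat} (v : 'cV[C]_n) : R := \sum_i normc (v i 0) ^+ 2.

Lemma cnorm2E {n} (v : 'cV[C]_n) :
  (cnorm2 v)%:C%C = (map_mx Num.conj v^T *m v) 0 0.
Proof.
rewrite mxE /cnorm2 (rmorph_sum (real_complex R)); apply: eq_bigr => i _.
rewrite !mxE mulrC -normCK rmorphXn /=; congr (_ ^+ 2).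
Qed.

Lemma cnorm2_unitary {n} (U : 'M[C]_n) v :
  U \is unitarymx -> cnorm2 (U *m v) = cnorm2 v.
Proof.
move=> /unitarymxP UU; apply: (@complexI R); rewrite !cnorm2E.
rewrite trmx_mul map_mxM mulmxA -(mulmxA (map_mx _ v^T)).
have -> : map_mx Num.conj U^T *m U = 1%:M by apply: mulmx1C.
by rewrite mulmx1.
Qed.

Lemma cnorm2_real {n} (v : 'cV[R]_n) :
  cnorm2 (map_mx (real_complex R) v) = enorm v ^+ 2.
Proof.
rewrite enorm_sq form1E /cnorm2; apply: eq_bigr => i _.
by rewrite mxE normc_sq /= expr0n addr0 expr2.
Qed.

Lemma map_Re_mul {n} (A : 'M[R]_n) (v : 'cV[C]_n) :
  map_mx (@complex.Re R) (map_mx (real_complex R) A *m v) =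
  A *m map_mx (@complex.Re R) v.
Proof.
apply/colP => i; rewrite !mxE Re_sum; apply: eq_bigr => j _; rewrite !mxE.
by case: (v j 0) => a b /=; rewrite mul0r subr0.
Qed.

Lemma map_Im_mul {n} (A : 'M[R]_n) (v : 'cV[C]_n) :
  map_mx (@complex.Im R) (map_mx (real_complex R) A *m v) =
  A *m map_mx (@complex.Im R) v.
Proof.
apply/colP => i; rewrite !mxE Im_sum; apply: eq_bigr => j _; rewrite !mxE.
by case: (v j 0) => a b /=; rewrite mul0r addr0.
Qed.

Lemma cnorm2_ReIm {n} (v : 'cV[C]_n) : cnorm2 v =
  enorm (map_mx (@complex.Re R) v) ^+ 2 + enorm (map_mx (@complex.Im R) v) ^+ 2.
Proof.
rewrite !enorm_sq !form1E -big_split; apply: eq_bigr => i _.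
by rewrite !mxE normc_sq !expr2.
Qed.

(** A real matrix acts separately on real and imaginary parts, so complexification does not increase
    its norm. *)
Lemma cnorm2_mulmx_le {n} (A : 'M[R]_n) (v : 'cV[C]_n) :
  cnorm2 (map_mx (real_complex R) A *m v) <= opnorm A ^+ 2 * cnorm2 v.
Proof.
rewrite !cnorm2_ReIm map_Re_mul map_Im_mul mulrDr -!exprMn.
by apply: lerD; rewrite ler_sqr ?nnegrE ?mulr_ge0 ?opnorm_ge0 ?enorm_ge0//
  enorm_mulmx_le.
Qed.

(** An entry is at most the norm of its column, and the unitary factors preserve norms. Hence the
    entries of the triangular form obey the same bound a as the matrix itself. *)
Lemma normc_entry_unitary {n} (A : 'M[R]_n) (U : 'M[C]_n) i j :
  U \is unitarymx ->
  normc ((U *m map_mx (real_complex R) A *m map_mx Num.conj U^T) i j) <= opnorm A.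
Proof.
move=> uU; set T := U *m _ *m _.
rewrite -ler_sqr; last 2 first.
- by rewrite nnegrE; exact: normc_ge0.
- by rewrite nnegrE; exact: opnorm_ge0.
have -> : T i j = (T *m delta_mx j (0 : 'I_1)) i 0 by rewrite -colE [RHS]mxE.
apply: (@le_trans _ _ (cnorm2 (T *m delta_mx j (0 : 'I_1)))).
  rewrite /cnorm2 (bigD1 i)//= lerDl sumr_ge0// => k _; exact: sqr_ge0.
rewrite /T -!mulmxA cnorm2_unitary// (le_trans (cnorm2_mulmx_le _ _))//.
rewrite cnorm2_unitary; last by rewrite trmxC_unitary.
suff -> : cnorm2 (delta_mx j 0) = 1 by rewrite mulr1.
rewrite /cnorm2 (bigD1 j)// mxE !eqxx normc1 expr1n big1 => [|k kj]; first exact: addr0.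
by rewrite mxE (negbTE kj) normc0 expr0n.
Qed.

End Complexification.

(** * Finiteness of the spectrum and positivity of the stability margin *)

Section StabilityMargin.
Context {R : realType} {n : nat}.
Implicit Types A : 'M[R]_n.

Lemma spectrum_finite A : exists s : seq R[i], forall l, spectrum A l <-> l \in s.
Proof.
have [s ps] := closed_field_poly_normal (char_poly (map_mx (real_complex R) A)).
exists s => l; rewrite /spectrum /= eigenvalue_root_char ps.
by rewrite (monicP (char_poly_monic _)) scale1r root_prod_XsubC.
Qed.

Context (n_gt0 : (0 < n)%N).

Lemma spectrum_nonempty A : spectrum A !=set0.
Proof. by have [l Al] := eigenvalue_closed (map_mx (real_complex R) A) n_gt0; exists l. Qed.

(** A supremum of negative numbers may be 0; finiteness of the spectrum provides a uniform gap d. *)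
Lemma stability_margin_gt0 A : hurwitz A -> 0 < stability_margin A.
Proof.
move=> hA; have [s As] := spectrum_finite A.
have [d d0 ds] : exists2 d : R, 0 < d & forall l, l \in s -> complex.Re l <= - d.
  have : forall l, l \in s -> complex.Re l < 0 by move=> l /As; exact: hA.
  elim: s {As} => [|z s IH] hs; first by exists 1.
  have [|d d0 ds] := IH; first by move=> l ls; apply: hs; rewrite in_cons ls orbT.
  have z0 : complex.Re z < 0 by apply: hs; rewrite mem_head.
  exists (Num.min d (- complex.Re z)); first by rewrite lt_min d0 oppr_gt0.
  move=> l; rewrite in_cons => /orP[/eqP ->|/ds ld].
    by rewrite lerNr ge_min lexx orbT.
  by rewrite lerNr ge_min lerNr ld.
rewrite /stability_margin oppr_gt0; apply: (@le_lt_trans _ _ (- d)); last by rewrite oppr_lt0.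
apply: ge_sup; first by have [l Al] := spectrum_nonempty A; exists (complex.Re l), l.
by move=> _ [l /As/ds ld <-].
Qed.

Lemma Re_le_stability_margin A l :
  hurwitz A -> spectrum A l -> complex.Re l <= - stability_margin A.
Proof.
move=> hA Al; rewrite opprK; apply: ub_le_sup; last by exists l.
by exists 0 => _ [z /hA/ltW z0 <-].
Qed.

End StabilityMargin.

(** * Bounds on sums with geometric weights below the diagonal *)

Section GeometricSums.
Context {R : realType} (k : R) (k0 : 0 <= k) (k1 : k < 1).

Lemma geometric_sum_le N : \sum_(i < N) k ^+ i.+1 <= k / (1 - k).
Proof.
have k1_ : 0 < 1 - k by rewrite subr_gt0.
rewrite ler_pdivlMr//.
have -> : (\sum_(i < N) k ^+ i.+1) * (1 - k) = k - k ^+ N.+1.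
  elim: N => [|N IH]; first by rewrite big_ord0; ring.
  by rewrite big_ord_recr /= mulrDl IH !exprS; ring.
by rewrite gerBl exprn_ge0.
Qed.

Lemma geometric_sum_below n (i : 'I_n) :
  \sum_(j < n | (j < i)%N) k ^+ (i - j) <= k / (1 - k).
Proof.
rewrite -(big_ord_widen n (fun j => k ^+ (i - j))) ?(ltnW (ltn_ord i))//.
rewrite (reindex_inj rev_ord_inj) /=.
rewrite (eq_bigr (fun j : 'I_i => k ^+ j.+1)) ?geometric_sum_le// => j _.
by rewrite subKn.
Qed.

(** Reversing the order of the indices turns this column sum into a row sum. *)
Lemma geometric_sum_above n (j : 'I_n) :
  \sum_(i < n | (j < i)%N) k ^+ (i - j) <= k / (1 - k).
Proof.
rewrite (reindex_inj rev_ord_inj) /=.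
rewrite (eq_big (fun i : 'I_n => (i < rev_ord j)%N) (fun i => k ^+ (rev_ord j - i)%N)).
- exact: geometric_sum_below.
- by move=> i /=; have := ltn_ord i; have := ltn_ord j; lia.
- by move=> i _ /=; congr (_ ^+ _); lia.
Qed.

(** Schur test: split [y i * y j] into half the sum of the squares, then bound the row sums and the
    column sums of the kernel, each by [k / (1 - k)]. *)
Lemma geometric_double_sum_le n (y : 'I_n -> R) :
  \sum_(i < n) \sum_(j < n | (j < i)%N) y i * y j * k ^+ (i - j) <=
  k / (1 - k) * \sum_i y i ^+ 2.
Proof.
apply: (@le_trans _ _ (\sum_(i < n) \sum_(j < n | (j < i)%N)
    ((y i ^+ 2 / 2 * k ^+ (i - j)) + (y j ^+ 2 / 2 * k ^+ (i - j))))).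
  apply: ler_sum => i _; apply: ler_sum => j _; rewrite -mulrDl.
  by apply: ler_wpM2r; [exact: exprn_ge0|have := sqr_ge0 (y i - y j); lra].
under eq_bigr do rewrite big_split /=.
rewrite big_split /=.
have -> : k / (1 - k) * (\sum_i y i ^+ 2) =
  (\sum_i y i ^+ 2 / 2 * (k / (1 - k))) + (\sum_i y i ^+ 2 / 2 * (k / (1 - k))).
  rewrite -big_split mulr_sumr; apply: eq_bigr => i _.
  by move: (k / (1 - k)) => g /=; field.
apply: lerD.
  apply: ler_sum => i _; rewrite -mulr_sumr ler_wpM2l ?geometric_sum_below//.
  by rewrite divr_ge0 ?sqr_ge0.
rewrite (exchange_big_dep xpredT)//=.
apply: ler_sum => j _; rewrite -mulr_sumr ler_wpM2l ?geometric_sum_above//.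
by rewrite divr_ge0 ?sqr_ge0.
Qed.

End GeometricSums.

(** * Dissipation of a weighted norm under a triangular matrix *)

Section TriangularLyapunov.
Context {R : realType} {n : nat}.
Local Notation C := R[i].

(* The weights K^(2(n-1-i)) damp the entries of T below the diagonal. *)
Definition tri_weight (K : R) (i : 'I_n) : R := K ^+ (n.-1 - i).

(** In the rescaled moduli [y i] the entry (i, j) below the diagonal carries a factor K^-(i-j). The
    resulting geometric series sums to 1/(K-1), so [4 * a = s * (K - 1)] limits the off-diagonal
    part to s/4 against -s from the diagonal; twice the difference is -3s/2, below -s. *)
Lemma triangular_dissipation (T : 'M[C]_n) (a s K : R) (z : 'cV[C]_n) :
  is_trig_mx T -> (forall i j, normc (T i j) <= a) ->
  (forall i, complex.Re (T i i) <= - s) -> 0 < s -> 1 < K ->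
  4 * a = s * (K - 1) ->
  2 * (\sum_i tri_weight K i ^+ 2 *
       complex.Re (conjc (z i 0) * (T *m z) i 0)) <=
  - s * \sum_i tri_weight K i ^+ 2 * normc (z i 0) ^+ 2.
Proof.
move=> /is_trig_mxP Ttrig Ta Tdiag s0 K1 Kas.
have K0 : 0 < K by lra.
have a0 : 0 <= a by nra.
pose y i := tri_weight K i * normc (z i 0).
have w0 i : 0 <= tri_weight K i by rewrite exprn_ge0 // ltW.
have y0 i : 0 <= y i by rewrite mulr_ge0 ?normc_ge0.
have -> : \sum_i tri_weight K i ^+ 2 * normc (z i 0) ^+ 2 = \sum_i y i ^+ 2.
  by apply: eq_bigr => i _; rewrite exprMn.
have offdiag (i j : 'I_n) : (j < i)%N ->
    tri_weight K i ^+ 2 * complex.Re (conjc (z i 0) * (T i j * z j 0)) <=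
    a * (y i * y j * K^-1 ^+ (i - j)).
  move=> ji; apply: (@le_trans _ _ (tri_weight K i ^+ 2 *
      (normc (z i 0) * (a * normc (z j 0))))).
    rewrite ler_wpM2l ?sqr_ge0// (le_trans (Re_le_normc _))//.
    rewrite !normcM normc_conj ler_wpM2l ?normc_ge0// ler_wpM2r ?normc_ge0//.
  rewrite le_eqVlt; apply/orP; left; apply/eqP; rewrite /y.
  have -> : tri_weight K i = tri_weight K j * K^-1 ^+ (i - j).
    rewrite /tri_weight; have -> : (n.-1 - j = (n.-1 - i) + (i - j))%N.
      by have := ltn_ord i; lia.
    by rewrite exprD -mulrA -exprMn mulfV ?gt_eqF// expr1n mulr1.
  ring.
have row (i : 'I_n) : tri_weight K i ^+ 2 * complex.Re (conjc (z i 0) * (T *m z) i 0) <=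
    - s * y i ^+ 2 + \sum_(j < n | (j < i)%N) a * (y i * y j * K^-1 ^+ (i - j)).
  rewrite mxE (bigID (fun j : 'I_n => (j < i)%N)) /= mulrDr.
  have -> : \sum_(j < n | ~~ (j < i)%N) T i j * z j 0 = T i i * z i 0.
    rewrite (bigD1 i) ?ltnn//= big1 ?addr0// => j /andP[].
    rewrite -leqNgt leq_eqVlt => /orP[/eqP/val_inj ->|ij _]; first by rewrite eqxx.
    by rewrite Ttrig// mul0r.
  have ReD (u v : C) : complex.Re (u + v) = complex.Re u + complex.Re v.
    by case: u; case: v.
  rewrite ReD mulrDr addrC mulr_sumr Re_sum mulr_sumr; apply: lerD; last first.
    by apply: ler_sum => j ji; exact: offdiag.
  have -> : complex.Re (conjc (z i 0) * (T i i * z i 0)) =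
      complex.Re (T i i) * normc (z i 0) ^+ 2.
    by rewrite normc_sq; case: (z i 0) (T i i) => c d [e f] /=; ring.
  by rewrite mulrCA /y exprMn ler_wpM2r// mulr_ge0// sqr_ge0.
apply: (@le_trans _ _ (2 * (- s * (\sum_i y i ^+ 2) +
    a * (K^-1 / (1 - K^-1) * \sum_i y i ^+ 2)))).
  rewrite ler_wpM2l// (le_trans (ler_sum _ (fun i _ => row i)))//.
  rewrite big_split /= -mulr_sumr lerD2l.
  rewrite (eq_bigr _ (fun i _ => esym (mulr_sumr _ _ _ _))) -mulr_sumr ler_wpM2l//.
  apply: geometric_double_sum_le; first by rewrite invr_ge0 ltW.
  by rewrite invf_lt1.
have -> : K^-1 / (1 - K^-1) = (K - 1)^-1.
  by field; apply/andP; split; lra.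
have -> : a * ((K - 1)^-1 * \sum_i y i ^+ 2) = s / 4 * \sum_i y i ^+ 2.
  have -> : a = s * (K - 1) / 4 by lra.
  by field; lra.
have : 0 <= \sum_i y i ^+ 2 by apply: sumr_ge0 => i _; exact: sqr_ge0.
nra.
Qed.

End TriangularLyapunov.

(** * The Lyapunov form of a Hurwitz matrix *)

Section HurwitzQuadraticForm.
Context {R : realType} {n : nat}.
Local Notation C := R[i].
Local Notation cplx := (map_mx (real_complex R)).

Lemma Re_mulmx_real (U : 'M[C]_n) (v : 'cV[R]_n) :
  map_mx (@complex.Re R) U *m v = map_mx (@complex.Re R) (U *m cplx v).
Proof.
apply/colP => i; rewrite !mxE Re_sum; apply: eq_bigr => j _; rewrite !mxE.
by case: (U i j) => a b /=; rewrite mulr0 subr0.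
Qed.

Lemma Im_mulmx_real (U : 'M[C]_n) (v : 'cV[R]_n) :
  map_mx (@complex.Im R) U *m v = map_mx (@complex.Im R) (U *m cplx v).
Proof.
apply/colP => i; rewrite !mxE Im_sum; apply: eq_bigr => j _; rewrite !mxE.
by case: (U i j) => a b /=; rewrite mulr0 add0r.
Qed.

Lemma form_diag (d : 'rV[R]_n) (u v : 'cV[R]_n) :
  form (diag_mx d) u v = \sum_i d 0 i * (u i 0 * v i 0).
Proof.
rewrite formE; apply: eq_bigr => i _; rewrite (bigD1 i)//= big1 => [|j ji].
  by rewrite mxE eqxx mulr1n addr0; ring.
by rewrite mxE eq_sym (negbTE ji) mulr0n mulr0 mul0r.
Qed.

(** The real part of U^* diag(d) U. On a real vector it gives the same quadratic form as the
    Hermitian matrix. *)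
Definition real_gram (U : 'M[C]_n) (d : 'rV[R]_n) : 'M[R]_n :=
  (map_mx (@complex.Re R) U)^T *m diag_mx d *m map_mx (@complex.Re R) U +
  (map_mx (@complex.Im R) U)^T *m diag_mx d *m map_mx (@complex.Im R) U.

Lemma real_gram_sym U d : (real_gram U d)^T = real_gram U d.
Proof.
by rewrite linearD /= !trmx_mul !trmxK tr_diag_mx !mulmxA.
Qed.

Lemma form_real_gram U d u v : form (real_gram U d) u v =
  \sum_i d 0 i * complex.Re (conjc ((U *m cplx u) i 0) * (U *m cplx v) i 0).
Proof.
rewrite formDm -!mulmxA !formMl !formMr !Re_mulmx_real !Im_mulmx_real !form_diag.
rewrite -big_split; apply: eq_bigr => i _; rewrite ![map_mx _ _ _ _]mxE.
by case: ((U *m cplx u) i 0) ((U *m cplx v) i 0) => a b [c e] /=; ring.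
Qed.

(* With U A U^* triangular (Schur), the form is |W U v|^2 for W the diagonal of
   the weights K^(n-1-i), K = 1 + 4a/sigma, so that W ranges between 1 and m. *)
Lemma hurwitz_quadratic_form (A : 'M[R]_n) : (0 < n)%N -> hurwitz A ->
  exists Q : 'M[R]_n, [/\ Q^T = Q,
    forall v, enorm v ^+ 2 <= form Q v v,
    forall v, form Q v v <= overshoot A ^+ 2 * enorm v ^+ 2 &
    forall v, 2 * form Q v (A *m v) <= - stability_margin A * form Q v v].
Proof.
move=> n0 hA; have [U uU Utrig] := Schur (cplx A) n0.
pose T := U *m cplx A *m map_mx Num.conj U^T.
have UU : map_mx Num.conj U^T *m U = 1%:M by apply: mulmx1C; exact/unitarymxP.
have conjT : conjmx U (cplx A) = T by rewrite conjymx.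
have Ttrig : is_trig_mx T by rewrite -conjT.
have Ta i j : normc (T i j) <= opnorm A by exact: normc_entry_unitary.
have s0 := stability_margin_gt0 n0 A hA.
(* The diagonal entries of a triangular matrix are its eigenvalues, and conjugation by U carries
   them back to [A]. *)
have Tdiag i : complex.Re (T i i) <= - stability_margin A.
  apply: Re_le_stability_margin => //; rewrite /spectrum /=.
  apply: (@eigenvalue_conjmx _ _ _ U); rewrite ?stablemx_unit ?row_free_unit ?unitarymx_unit//.
  rewrite conjT unfold_in /= -/(eigenvalue T (T i i)).
  rewrite eigenvalue_root_char char_poly_trig//.
  by rewrite /root horner_prod (bigD1 i)//= hornerXsubC subrr mul0r.
set s := stability_margin A in s0 Tdiag *.
pose K := 1 + 4 * opnorm A / s.
(* Any diagonal entry yields s <= - Re T_ii <= |T_ii| <= a. *)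
have a0 : 0 < opnorm A.
  apply: lt_le_trans s0 _; have i : 'I_n by case: (n) n0 => // k _; exact: ord0.
  apply: le_trans (Ta i i); rewrite -normcN; apply: le_trans (Re_le_normc _).
  by rewrite raddfN /= lerNr Tdiag.
have K1 : 1 < K by rewrite ltrDl divr_gt0// mulr_gt0.
have Kas : 4 * opnorm A = s * (K - 1) by rewrite /K; field; rewrite gt_eqF.
pose d : 'rV[R]_n := \row_i tri_weight K i ^+ 2.
have Re_sq (v : 'cV[R]_n) i : d 0 i * complex.Re (conjc ((U *m cplx v) i 0) * (U *m cplx v) i 0)
    = tri_weight K i ^+ 2 * normc ((U *m cplx v) i 0) ^+ 2.
  rewrite mxE; congr (_ * _); rewrite normc_sq.
  by case: ((U *m cplx v) i 0) => a b /=; ring.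
have formQ v : form (real_gram U d) v v =
    \sum_i tri_weight K i ^+ 2 * normc ((U *m cplx v) i 0) ^+ 2.
  by rewrite form_real_gram; apply: eq_bigr => i _.
have enormU v : enorm v ^+ 2 = \sum_i normc ((U *m cplx v) i 0) ^+ 2.
  by rewrite -cnorm2_real -(cnorm2_unitary _ _ uU).
exists (real_gram U d); split; first exact: real_gram_sym.
- move=> v; rewrite formQ enormU; apply: ler_sum => i _.
  by rewrite ler_peMl ?sqr_ge0// -exprM exprn_ege1// ltW.
- move=> v; rewrite formQ enormU mulr_sumr; apply: ler_sum => i _.
  rewrite ler_wpM2r ?sqr_ge0// ler_sqr ?nnegrE ?exprn_ge0 ?(ltW (lt_trans ltr01 K1))//.
  by rewrite ler_weXn2l ?(ltW K1)// leq_subr.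
- move=> v; rewrite formQ form_real_gram.
  have -> : U *m cplx (A *m v) = T *m (U *m cplx v).
    by rewrite map_mxM /T -!mulmxA (mulmxA _ U) UU mul1mx.
  under eq_bigr do rewrite mxE.
  exact: triangular_dissipation Tdiag _ _ _.
Qed.

End HurwitzQuadraticForm.

(** * Comparison of Lyapunov forms for the same matrix *)

Section LyapunovComparison.
Context {R : realType} {n : nat}.
Implicit Types (P Q A : 'M[R]_n) (v : 'cV[R]_n).

Lemma form_ge0_of_posdef P v : sym_posdef P -> 0 <= form P v v.
Proof.
move=> [_ Ppos]; have [->|/Ppos/ltW//] := eqVneq v 0.
by rewrite /form mulmx0 mxE.
Qed.

(* c = sup {c <= s | c P <= Q} equals s: if c < s, the bound
   2 (Q - c P)(v, A v) <= c - s on unit vectors and Cauchy-Schwarz keep Q - c P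
   away from 0, so that c can be increased. *)
Lemma lyapunov_comparison P Q A (s : R) : (0 < n)%N ->
  sym_posdef P -> Q^T = Q -> (forall v, enorm v ^+ 2 <= form Q v v) ->
  (forall v, 2 * form P v (A *m v) = - enorm v ^+ 2) ->
  (forall v, 2 * form Q v (A *m v) <= - s * form Q v v) -> 0 < s ->
  forall v, s * form P v v <= form Q v v.
Proof.
move=> n0 Ppd Qsym Qge PA QA s0.
have P0 v : 0 <= form P v v by exact: form_ge0_of_posdef.
pose S := [set c : R | c <= s /\ forall v, c * form P v v <= form Q v v].
have S0 : S 0 by split=> [|v]; [exact: ltW|rewrite mul0r (le_trans (sqr_ge0 _) (Qge v))].
have supS : has_sup S by split; [exists 0|exists s => c []].
have c0 : 0 <= sup S by apply: ub_le_sup => //; exact: supS.2.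
have Sc : S (sup S).
  split; first by apply: ge_sup => [|c []]//; exists 0.
  move=> v; have [v0|v0] := eqVneq (form P v v) 0.
    by rewrite v0 mulr0 (le_trans (sqr_ge0 _) (Qge v)).
  have vgt0 : 0 < form P v v by rewrite lt_def v0 P0.
  rewrite -ler_pdivlMr//; apply: ge_sup; first by exists 0.
  by move=> c [_ /(_ v)]; rewrite ler_pdivlMr.
set c := sup S in c0 Sc.
have [sc|cs] := leP s c; first by move=> v; apply: le_trans (Sc.2 v); rewrite ler_wpM2r.
have [C C0 hC] := form_bounded (A^T *m Q *m A).
have [D D0 hD] := form_bounded P.
pose eta := (s - c) ^+ 2 / (4 * C).
have eta0 : 0 < eta by rewrite divr_gt0 ?exprn_gt0 ?subr_gt0 ?mulr_gt0.
pose W := Q - c *: P.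
have WE u w : form W u w = form Q u w - c * form P u w.
  by rewrite formDm formNm formZm.
have W0 v : 0 <= form W v v by rewrite WE subr_ge0; exact: Sc.2.
have Wsym : W^T = W by rewrite /W linearB /= linearZ /= -Ppd.1 Qsym.
have Wunit v : eta * enorm v ^+ 2 <= form W v v.
  have [->|v0] := eqVneq v 0; first by rewrite enorm0 expr0n mulr0.
  have N0 : 0 < enorm v ^+ 2 by rewrite exprn_gt0// lt_def enorm_eq0 v0 enorm_ge0.
  (* By [QA] and [PA] the left side is at most - s Q(v,v) + c |v|^2, and Q(v,v) >= |v|^2. *)
  have WA : 2 * form W v (A *m v) <= (c - s) * enorm v ^+ 2.
    have := QA v; have := PA v; have := Qge v; rewrite WE; nra.
  have CS := form_CauchySchwarz _ v (A *m v) Wsym W0.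
  have WAA : form W (A *m v) (A *m v) <= C * enorm v ^+ 2.
    apply: le_trans (hC v); rewrite formMr formMl WE.
    by rewrite gerBl mulr_ge0.
  have sq : ((s - c) * enorm v ^+ 2) ^+ 2 <= 4 * form W v (A *m v) ^+ 2.
    have : 0 <= (s - c) * enorm v ^+ 2 by rewrite mulr_ge0 ?subr_ge0 ?ltW.
    move: WA; set z := form W v _ => WA h; nra.
  have : ((s - c) * enorm v ^+ 2) ^+ 2 <= 4 * (form W v v * (C * enorm v ^+ 2)).
    apply: le_trans sq _; rewrite ler_wpM2l//.
    by apply: le_trans CS _; rewrite ler_wpM2l.
  have -> : 4 * (form W v v * (C * enorm v ^+ 2)) =
    4 * C * form W v v * enorm v ^+ 2 by ring.
  have -> : ((s - c) * enorm v ^+ 2) ^+ 2 =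
    (s - c) ^+ 2 * enorm v ^+ 2 * enorm v ^+ 2 by ring.
  rewrite ler_pM2r// => h.
  by rewrite /eta mulrAC ler_pdivrMr ?mulr_gt0// [leRHS]mulrC.
(* The first bound gives d P(v,v) <= d D |v|^2 <= eta |v|^2 <= W(v,v); the second keeps c + d below
   s. *)
pose d := Num.min (eta / D) (s - c).
have d0 : 0 < d by rewrite lt_min divr_gt0//= subr_gt0.
have : S (c + d).
  split; first by rewrite -lerBrDl /d ge_min lexx orbT.
  move=> v; rewrite mulrDl -lerBrDl -WE (le_trans _ (Wunit v))//.
  have dD : d * D <= eta by rewrite -ler_pdivlMr// /d ge_min lexx.
  have := hD v; have := P0 v; have := sqr_ge0 (enorm v).
  move: (form P v v) (enorm v ^+ 2) => p e e0 p0 pe.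
  apply: (@le_trans _ _ (d * (D * e))); first by rewrite ler_wpM2l ?(ltW d0).
  by rewrite mulrA ler_wpM2r.
move=> /(ub_le_sup supS.2); rewrite -/c; lra.
Qed.

End LyapunovComparison.

(** * Monotonicity of absolutely continuous functions from the sign of the derivative *)

Section AbsolutelyContinuous.
Context {R : realType}.
Implicit Types (f : R -> R) (T eps delta t : R).

Lemma le_lebesgue_measure (A B : set R) : measurable A -> measurable B ->
  A `<=` B -> (lebesgue_measure A <= lebesgue_measure B)%E.
Proof.
by move=> mA mB; exact: (@le_measure _ _ _ (@lebesgue_measure R) A B
  (mem_set mA) (mem_set mB)).
Qed.

Definition abs_cont_mod f T eps delta : Prop :=
  forall (m : nat) (u v : 'I_m -> R),
    (forall k, 0 <= u k /\ u k <= v k /\ v k <= T) ->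
    (forall k l, k != l -> v k <= u l \/ v l <= u k) ->
    \sum_(k < m) (v k - u k) < delta ->
    \sum_(k < m) `|f (v k) - f (u k)| < eps.

Definition loc_abs_cont f : Prop := forall T eps, 0 < T -> 0 < eps ->
  exists2 delta, 0 < delta & abs_cont_mod f T eps delta.

(** Lists, with the rightmost interval first, let the real induction add an interval by a cons
    instead of reindexing a finite family. *)
Lemma abs_cont_mod_seq f T eps delta (s : seq (R * R)) :
  abs_cont_mod f T eps delta ->
  (forall p, p \in s -> 0 <= p.1 /\ p.1 <= p.2 /\ p.2 <= T) ->
  pairwise (fun p q => q.2 <= p.1) s ->
  \sum_(p <- s) (p.2 - p.1) < delta ->
  \sum_(p <- s) (f p.2 - f p.1) < eps.
Proof.
move=> fT sT /(pairwiseP (0, 0)) sdisj; rewrite !(big_nth (0, 0)) !big_mkord => sd.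
apply: le_lt_trans (fT (size s) (fun k => (nth (0, 0) s k).1)
  (fun k => (nth (0, 0) s k).2) _ _ sd).
- by apply: ler_sum => i _; exact: ler_norm.
- by move=> k; apply: sT; rewrite mem_nth.
- move=> k l; rewrite -val_eqE neq_ltn => /orP[kl|lk].
    by right; apply: (sdisj k l) => //; exact: ltn_ord.
  by left; apply: (sdisj l k) => //; exact: ltn_ord.
Qed.

(** The slope eps absorbs the case of derivative 0. Both sides are needed: t serves as a right
    endpoint when a supremum is reached and as a left endpoint when it is passed. *)
Lemma is_derive_le0_near f t l eps :
  is_derive t (1 : R) f l -> l <= 0 -> 0 < eps ->
  exists2 d, 0 < d & forall s, `|s - t| < d ->
    (t <= s -> f s - f t <= eps * (s - t)) /\
    (s <= t -> f t - f s <= eps * (t - s)).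
Proof.
move=> [df dfl] l0 e0.
have /(_ eps e0) : forall e : R, 0 < e -> \forall h \near 0^',
    h^-1 *: (f (h *: 1 + t) - f t) < e.
  move=> e ep; have /cvgr_lt : (fun h => h^-1 *: (f (h *: 1 + t) - f t)) @ 0^' --> 'D_1 f t.
    exact: df.
  by apply; rewrite dfl (le_lt_trans l0).
rewrite /dnbhs /within /= => /nbhs_ballP[d /= d0 hd]; exists d => // s sd.
have [->|st] := eqVneq s t; first by rewrite !subrr mulr0.
have := hd (s - t); rewrite /ball /= sub0r normrN subr_eq0 => /(_ sd st).
rewrite /= [_ *: 1]mulr1 subrK => h.
have {}h : (s - t)^-1 * (f s - f t) < eps by [].
split=> le.
  have st0 : 0 < s - t by rewrite subr_gt0 lt_neqAle eq_sym st.
  by rewrite -ler_pdivrMr// mulrC ltW.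
have st0 : 0 < t - s by rewrite subr_gt0 lt_neqAle st.
rewrite -ler_pdivrMr// mulrC ltW//; move: h.
by rewrite -(opprB t s) -(opprB (f t)) invrN mulrNN.
Qed.

(* Real induction on t, collecting intervals contained in O: their total length is
   at most the measure of O, so absolute continuity bounds what they contribute. *)
Lemma abs_cont_covered_le f T eps delta (O : set R) :
  0 <= T -> 0 <= eps -> abs_cont_mod f T eps delta -> measurable O ->
  (lebesgue_measure O < delta%:E)%E ->
  (forall t, 0 <= t -> t <= T -> exists2 d, 0 < d & forall a b,
    `|a - t| < d -> `|b - t| < d -> a <= b -> a = t \/ b = t ->
    (`]a, b]%classic `<=` O) \/ f b - f a <= eps * (b - a)) ->
  f T - f 0 <= eps * T + eps.
Proof.
move=> T0 e0 fT mO Od step.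
pose mu t := lebesgue_measure (O `&` `[0, t]%classic).
(* Total length is compared with the part of O to the left of t rather than with all of O; this
   makes the bound inductive. *)
pose S := [set t | 0 <= t /\ t <= T /\ exists s : seq (R * R),
  [/\ (forall p, p \in s -> 0 <= p.1 /\ p.1 <= p.2 /\ p.2 <= t),
      pairwise (fun p q => q.2 <= p.1) s,
      ((\sum_(p <- s) (p.2 - p.1))%:E <= mu t)%E &
      f t - f 0 <= eps * t + \sum_(p <- s) (f p.2 - f p.1)]].
have mOt t : measurable (O `&` `[0, t]%classic) by apply: measurableI.
have muS a b : a <= b -> (mu a <= mu b)%E.
  move=> ab; apply: le_lebesgue_measure => // x [Ox].
  rewrite /= !in_itv /= => /andP[x0 xa]; split=> //.
  by rewrite x0 (le_trans xa).
have extend a b : S a -> a <= b -> b <= T ->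
    (`]a, b]%classic `<=` O) \/ f b - f a <= eps * (b - a) -> S b.
  move=> [a0 [aT [s [s1 s2 s3 s4]]]] ab bT h; split; first exact: le_trans ab.
  split=> //; case: h => h; last first.
    exists s; split => //; last by move: s4 h; lra.
    - by move=> p /s1[p1 [p2 p3]]; split=> //; split=> //; exact: le_trans ab.
    - exact: le_trans (muS _ _ ab).
  exists ((a, b) :: s); split.
  - move=> p; rewrite in_cons => /orP[/eqP -> //|/s1[p1 [p2 p3]]].
    by split=> //; split=> //; exact: le_trans ab.
  - by rewrite /= s2 andbT; apply/allP => p /s1[_ []].
  - rewrite big_cons /= EFinD addeC.
    (* The half-open interval is disjoint from [[0, a]], so its length adds to [mu a] without
       overlap. *)
    apply: (@le_trans _ _ (mu a + lebesgue_measure `]a, b]%classic)%E).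
      apply: leeD => //; rewrite lebesgue_measure_itv /= lte_fin.
      by case: ltP => // ba; rewrite lee_fin; lra.
    rewrite /mu -measureU//.
      apply: le_lebesgue_measure => //; first exact: measurableU.
      move=> x [[Ox]|]; rewrite /= !in_itv /= => /andP[x1 x2]; split=> //.
      + by rewrite x1 (le_trans x2).
      + by apply: h; rewrite /= in_itv /= x1.
      + by rewrite x2 (le_trans a0)// ltW.
      exact: mOt.
    apply/seteqP; split=> // x [[_]]; rewrite /= !in_itv /= => /andP[_ xa] /andP[ax _].
    by move: xa; rewrite leNgt ax.
  - by rewrite big_cons /=; have := ler_wpM2l e0 ab; move: s4; lra.
have S0 : S 0.
  split=> //; split=> //; exists [::]; rewrite !big_nil; split=> //.
  by rewrite subrr mulr0 addr0.
have supS : has_sup S by split; [exists 0|exists T => t [_ []]].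
have c0 : 0 <= sup S by apply: ub_le_sup => //; exact: supS.2.
have cT : sup S <= T by apply: ge_sup; [exists 0|move=> t [_ []]].
have [d d0 hd] := step _ c0 cT.
have cc : `|sup S - sup S| < d by rewrite subrr normr0.
(* The local hypothesis at [sup S] is used twice: to reach it from a nearby element of S and, if it
   lies below T, to pass it. *)
have Sc : S (sup S).
  have [a Sa ca] := sup_adherent d0 supS.
  have ac : a <= sup S by apply: ub_le_sup => //; exact: supS.2.
  by apply: (extend a) => //; apply: hd => //; [rewrite ler0_norm; lra|right].
have ScT : S T.
  have [cT'|cT'] := ltP (sup S) T; last by rewrite (@le_anti _ _ T (sup S)) ?cT' ?cT.
  pose b := Num.min T (sup S + d / 2).
  have cb : sup S < b by rewrite lt_min cT' ltrDl divr_gt0.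
  have bT : b <= T by rewrite ge_min lexx.
  have bd : b <= sup S + d / 2 by rewrite ge_min lexx orbT.
  have Sb : S b.
    apply: (extend (sup S)) => //; first exact: ltW.
    apply: hd => //; [rewrite ger0_norm; lra|exact: ltW|by left].
  have := ub_le_sup supS.2 Sb; lra.
have [_ [_ [s [s1 s2 s3 s4]]]] := ScT.
apply: le_trans s4 _; rewrite lerD2l ltW//; apply: abs_cont_mod_seq fT s1 s2 _.
rewrite -lte_fin (le_lt_trans s3)// (le_lt_trans _ Od)//.
by apply: le_lebesgue_measure => // x [].
Qed.

(** Outside a small open set around the exceptional points f grows locally with slope at most eps,
    and inside it absolute continuity limits the total increase to eps. Then eps tends to 0. *)
Lemma loc_abs_cont_nonincreasing f : loc_abs_cont f ->
  {ae @lebesgue_measure R, forall t, 0 < t ->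
    exists2 l, is_derive t (1 : R) f l & l <= 0} ->
  forall T, 0 <= T -> f T <= f 0.
Proof.
move=> fAC [N [mN N0 fN]] T; rewrite le_eqVlt => /orP[/eqP<-//|T0].
suff h eps : 0 < eps -> f T - f 0 <= eps * T + eps.
  rewrite -subr_le0; apply/ler_addgt0Pr => e e0; rewrite add0r.
  have T1 : 0 < T + 1 by rewrite addr_gt0.
  have /h : 0 < e / (T + 1) by rewrite divr_gt0.
  have -> : e / (T + 1) * T + e / (T + 1) = e by field; rewrite gt_eqF.
  by [].
move=> e0; have [delta d0 fT] := fAC _ _ T0 e0.
(* The point 0 joins the exceptional set: the derivative is controlled only for t > 0, while the
   induction starts at 0. *)
have mN0 : measurable (N `|` [set 0]) by apply: measurableU.
have N00 : (lebesgue_measure (N `|` [set 0%R]) = 0 :> \bar R)%E.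
  by rewrite measureU0//; exact: lebesgue_measure_set1.
have N0fin : (lebesgue_measure (N `|` [set 0%R]) < +oo :> \bar R)%E by rewrite N00.
have [V [oO NO Od]] := lebesgue_regularity_outer mN0 N0fin d0.
apply: (@abs_cont_covered_le _ T eps delta V) => //; [exact: ltW|exact: ltW|..].
- exact: measurable_realfun.open_measurable.
(* Regularity bounds V minus the null set; putting the null set back leaves the measure
   unchanged. *)
- apply: le_lt_trans Od.
  have mV : measurable V by exact: measurable_realfun.open_measurable.
  have mVN : measurable (V `\` (N `|` [set 0])) by exact: measurableD.
  rewrite -[leRHS]adde0 -N00 -measureU ?setDIK//.
    apply: le_lebesgue_measure => //; first exact: measurableU.
    by move=> x Vx; have [?|?] := pselect ((N `|` [set 0]) x); [right|left].
  by apply/seteqP; split=> // x [[_ h] /h].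
move=> t t0 tT; have [Ot|Ot] := pselect (V t).
  have /nbhs_ballP[d /= dgt0 hd] := open_nbhs_nbhs (conj oO Ot).
  exists d => // a b at_ bt ab _; left => y /=; rewrite in_itv /= => /andP[ay yb].
  apply: hd; rewrite /ball /= distrC ltr_norml; move: at_ bt; rewrite !ltr_norml.
  by move=> /andP[? ?] /andP[? ?]; apply/andP; split; lra.
have tgt0 : 0 < t.
  by rewrite lt_neqAle t0 andbT; apply/eqP => t00; apply: Ot; apply: NO; right.
have [l fl l0] : exists2 l, is_derive t (1 : R) f l & l <= 0.
  have : ~ N t by move=> Nt; apply: Ot; apply: NO; left.
  by move=> Nt; apply: contrapT => nl; apply: Nt; apply: fN => /(_ tgt0).
have [d dgt0 hd] := is_derive_le0_near f t l eps fl l0 e0.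
exists d => // a b at_ bt ab abt; right.
move: ab; case: abt => -> ab.
  by case: (hd b bt) => + _; apply.
by case: (hd a at_) => _; apply.
Qed.

End AbsolutelyContinuous.

(** * Closure properties of absolute continuity, and derivatives of forms along curves *)

Section LocAbsContClosure.
Context {R : realType}.
Implicit Types f g : R -> R.

Lemma loc_abs_cont_cst (c : R) : loc_abs_cont (fun=> c).
Proof.
move=> T eps T0 e0; exists 1 => // m u v _ _ _.
by rewrite big1// => k _; rewrite subrr normr0.
Qed.

Lemma loc_abs_contD f g : loc_abs_cont f -> loc_abs_cont g ->
  loc_abs_cont (fun t => f t + g t).
Proof.
move=> hf hg T eps T0 e0; have e20 : 0 < eps / 2 by rewrite divr_gt0.
have [d1 d10 h1] := hf T _ T0 e20; have [d2 d20 h2] := hg T _ T0 e20.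
exists (Num.min d1 d2); first by rewrite lt_min d10.
move=> m u v uv disj; rewrite lt_min => /andP[s1 s2].
apply: (@le_lt_trans _ _ (\sum_(k < m) `|f (v k) - f (u k)| +
    \sum_(k < m) `|g (v k) - g (u k)|)).
  rewrite -big_split; apply: ler_sum => k _ /=.
  by rewrite opprD addrACA ler_normD.
have := h1 m u v uv disj s1; have := h2 m u v uv disj s2; lra.
Qed.

(** A step of length at most d/2 changes f by less than 1, and finitely many such steps cover
    [0, T]. *)
Lemma loc_abs_cont_bounded f T : loc_abs_cont f -> 0 < T ->
  exists2 B, 0 < B & forall t, 0 <= t -> t <= T -> `|f t| <= B.
Proof.
move=> hf T0; have [d d0 hd] := hf T 1 T0 ltr01.
have near a b : 0 <= a -> a <= b -> b <= T -> b - a < d -> `|f b - f a| < 1.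
  move=> a0 ab bT bad; have := hd 1 (fun=> a) (fun=> b).
  rewrite !big_ord1; apply=> // k l; by rewrite !ord1.
have [N hN] : exists N : nat, T / (d / 2) <= N%:R.
  by exists (Num.bound (T / (d / 2))); apply/ltW/archi_boundP; rewrite divr_ge0 ?divr_ge0 ?ltW.
have grow k t : 0 <= t -> t <= T -> t <= k%:R * (d / 2) -> `|f t| <= `|f 0| + k%:R.
  elim: k t => [|k IH] t t0 tT; first by rewrite mul0r addr0 => ?;
    rewrite (@le_anti _ _ t 0) ?t0 ?andbT.
  rewrite -natr1 mulrDl mul1r => tk; have [s [s0 st sk sd]] :
      exists s, [/\ 0 <= s, s <= t, s <= k%:R * (d / 2) & t - s < d].
    have [td|dt] := ltP t (d / 2).
      by exists 0; split=> //; [rewrite mulr_ge0// ltW// divr_gt0|lra].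
    by exists (t - d / 2); split; lra.
  have := near s t s0 st tT sd; have := IH s s0 (le_trans st tT) sk.
  have := ler_normD (f t - f s) (f s); rewrite subrK; lra.
exists (`|f 0| + N%:R + 1); first by rewrite ltr_wpDl// addr_ge0.
move=> t t0 tT; apply: (@le_trans _ _ (`|f 0| + N%:R)); last by rewrite lerDl.
apply: grow => //; apply: le_trans tT _.
by rewrite -ler_pdivrMr ?divr_gt0.
Qed.

Lemma loc_abs_contM f g : loc_abs_cont f -> loc_abs_cont g ->
  loc_abs_cont (fun t => f t * g t).
Proof.
move=> hf hg T eps T0 e0.
have [A A0 fA] := loc_abs_cont_bounded f T hf T0.
have [B B0 gB] := loc_abs_cont_bounded g T hg T0.
have eB : 0 < eps / (2 * B) by rewrite divr_gt0 ?mulr_gt0.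
have eA : 0 < eps / (2 * A) by rewrite divr_gt0 ?mulr_gt0.
have [d1 d10 h1] := hf T _ T0 eB; have [d2 d20 h2] := hg T _ T0 eA.
exists (Num.min d1 d2); first by rewrite lt_min d10.
move=> m u v uv disj; rewrite lt_min => /andP[s1 s2].
apply: (@le_lt_trans _ _ (B * (\sum_(k < m) `|f (v k) - f (u k)|) +
    A * \sum_(k < m) `|g (v k) - g (u k)|)).
  rewrite !mulr_sumr -big_split; apply: ler_sum => k _ /=.
  have [u0 [uvk vT]] := uv k.
  have -> : f (v k) * g (v k) - f (u k) * g (u k) =
    (f (v k) - f (u k)) * g (v k) + f (u k) * (g (v k) - g (u k)) by ring.
  rewrite (le_trans (ler_normD _ _))// !normrM lerD//.
    by rewrite mulrC ler_wpM2r// gB// (le_trans u0).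
  by rewrite ler_wpM2r// fA// (le_trans uvk).
have := h1 m u v uv disj s1; have := h2 m u v uv disj s2.
rewrite !ltr_pdivlMr ?mulr_gt0//; lra.
Qed.

Lemma loc_abs_cont_sum (n : nat) (F : 'I_n -> R -> R) :
  (forall i, loc_abs_cont (F i)) -> loc_abs_cont (fun t => \sum_i F i t).
Proof.
elim: n F => [|n IH] F hF.
  rewrite (_ : (fun t => _) = fun=> 0); first exact: loc_abs_cont_cst.
  by apply/funext => t; rewrite big_ord0.
rewrite (_ : (fun t => _) = fun t => F ord0 t + \sum_(i < n) F (lift ord0 i) t).
  by apply: loc_abs_contD => //; exact: IH.
by apply/funext => t; rewrite big_ord_recl.
Qed.

Context {n : nat}.
Implicit Types (y z : R -> 'cV[R]_n) (M : 'M[R]_n).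

Lemma loc_abs_cont_entry y i : locally_abs_continuous y ->
  loc_abs_cont (fun t => y t i 0).
Proof.
move=> hy T eps T0 e0; have [d d0 hd] := hy T eps T0 e0; exists d => // m u v uv disj s.
apply: le_lt_trans (hd m u v uv disj s); apply: ler_sum => k _.
by have := enorm_entry (y (v k) - y (u k)) i; rewrite !mxE.
Qed.

Definition entrywise_abs_cont y := forall i, loc_abs_cont (fun t => y t i 0).

Lemma entrywise_abs_contB y z : entrywise_abs_cont y -> entrywise_abs_cont z ->
  entrywise_abs_cont (fun t => y t - z t).
Proof.
move=> hy hz i; rewrite (_ : (fun t => _) = fun t => y t i 0 + (-1) * z t i 0).
  by apply: loc_abs_contD => //; apply: loc_abs_contM => //; exact: loc_abs_cont_cst.
by apply/funext => t; rewrite !mxE mulN1r.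
Qed.

Lemma loc_abs_cont_form M y z : entrywise_abs_cont y -> entrywise_abs_cont z ->
  loc_abs_cont (fun t => form M (y t) (z t)).
Proof.
move=> hy hz; under eq_fun do rewrite formE.
apply: loc_abs_cont_sum => i; apply: loc_abs_cont_sum => j.
by do 2![apply: loc_abs_contM => //]; exact: loc_abs_cont_cst.
Qed.

Lemma is_derive_entry y t v dy i :
  is_derive t v y dy -> is_derive t v (fun s => y s i 0) (dy i 0).
Proof.
move=> [dery <-]; have /derivable_mxP h := dery; apply: DeriveDef; first exact: h.
by rewrite derive_mx// mxE.
Qed.

Lemma is_derive_subr y z (t : R) dy dz d :
  is_derive t (1 : R) y dy -> is_derive t (1 : R) z dz -> dy - dz = d ->
  is_derive t (1 : R) (fun s => y s - z s) d.
Proof. by move=> hy hz <-; exact: (is_deriveB hy hz). Qed.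

Lemma is_derive_form M y z (t : R) dy dz :
  is_derive t (1 : R) y dy -> is_derive t (1 : R) z dz ->
  is_derive t (1 : R) (fun s => form M (y s) (z s))
    (form M dy (z t) + form M (y t) dz).
Proof.
move=> hy hz.
have -> : (fun s => form M (y s) (z s)) = \sum_(i < n) \sum_(j < n)
    (M i j \*: ((fun s => y s i 0) * (fun s => z s j 0))).
  apply/funext => s; rewrite formE fct_sumE; apply: eq_bigr => i _.
  rewrite fct_sumE; apply: eq_bigr => j _.
  transitivity (M i j * (y s i 0 * z s j 0)); [ring|by []].
apply: is_derive_eq.
  apply: is_derive_sum => i; apply: is_derive_sum => j; apply: is_deriveZ.
  by apply: is_deriveM; exact: is_derive_entry.
rewrite !formE -big_split; apply: eq_bigr => i _.
rewrite -big_split; apply: eq_bigr => j _ /=.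
by rewrite /GRing.scale /=; ring.
Qed.

End LocAbsContClosure.

(** * The projection operator and its sign property *)

Section ProjectionOperator.
Context {R : realType} {n : nat}.
Implicit Types (th y : 'cV[R]_n) (vartheta eps gamma : R).

Lemma grad_proj_fun vartheta eps th : grad (proj_fun vartheta eps) th =
  (2 / (2 * eps * vartheta + eps ^+ 2)) *: th.
Proof.
apply/colP => i; rewrite !mxE; set c := 2 * eps * vartheta + eps ^+ 2.
set w := delta_mx i 0.
have thw : form 1%:M th w = th i 0.
  rewrite form1E (bigD1 i)//= /w mxE !eqxx mulr1 big1 ?addr0// => j ji.
  by rewrite mxE (negbTE ji) mulr0.
rewrite /derive; apply: cvg_lim => //.
rewrite -thw; pose q := form 1%:M w w.
(* As f is quadratic, its difference quotient is exactly affine in h. *)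
apply: (@cvg_trans _ ((fun h : R => (h * q + 2 * form 1%:M th w) / c) @ 0^')).
  apply: near_eq_cvg; near=> h.
  have h0 : h != 0 by near: h; exact: nbhs_dnbhs_neq.
  rewrite /= /proj_fun -/c !enorm_sq formDl !formDr !formZl !formZr -/q.
  rewrite (form_sym _ w th) ?trmx1// /GRing.scale /=.
  by move: (c^-1) => d; field.
have -> : 2 / c * form 1%:M th w = (0 * q + 2 * form 1%:M th w) / c by ring.
apply: cvgMl; apply: cvgD; last exact: cvg_cst.
apply: cvgMl; exact: cvg_within.
Unshelve. all: by end_near. Qed.

(** For a scalar Gamma one factor gamma cancels in the quotient: the correction is f gamma times the
    orthogonal projection of y onto the gradient. *)
Lemma form1_Proj gamma th y d (f : 'cV[R]_n -> R) :
  0 < gamma ->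
  form 1%:M d (Proj gamma%:M th y f) = gamma * form 1%:M d y -
    if (0 < f th) && (0 < form 1%:M y (grad f th))
    then f th * (gamma * (form 1%:M (grad f th) y / form 1%:M (grad f th) (grad f th)))
         * form 1%:M d (grad f th)
    else 0.
Proof.
move=> g0; rewrite /Proj; set g := grad f th.
have scal u v : (u^T *m gamma%:M *m v) 0 0 = gamma * form 1%:M u v.
  by rewrite /form mulmx1 mul_mx_scalar -scalemxAl mxE.
rewrite !scal pmulr_rgt0//.
case: ifP => _; last by rewrite mul_scalar_mx formZr subr0.
rewrite formDr formNr mul_scalar_mx !formZr; congr (_ - _).
rewrite -!mulmxA !mul_scalar_mx -scalemxAl -!scalemxAr -mulmxA.
rewrite [g^T *m y]mx11_scalar mul_mx_scalar !formZr.
have -> : (g^T *m y) 0 0 = form 1%:M g y by rewrite /form mulmx1.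
rewrite invfM; set k := (form 1%:M g g)^-1.
by field; rewrite gt_eqF.
Qed.

(* Outside the ball of radius vartheta, the gradient of f (a multiple of th)
   makes an acute angle with th - th_star, and the correction removes a
   nonnegative multiple of it. *)
Lemma form1_Proj_le vartheta eps gamma th th_star y :
  0 < vartheta -> 0 < eps -> 0 < gamma -> enorm th_star <= vartheta ->
  form 1%:M (th - th_star) (Proj gamma%:M th y (proj_fun vartheta eps)) <=
  gamma * form 1%:M (th - th_star) y.
Proof.
move=> v0 e0 g0 ths; rewrite form1_Proj//; case: ifP => [/andP[f0]|_]; last by rewrite subr0.
have c0 : 0 < 2 * eps * vartheta + eps ^+ 2 by rewrite addr_gt0 ?mulr_gt0 ?exprn_gt0.
rewrite (form_sym _ y) ?trmx1// => gy0; rewrite gerBl.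
rewrite mulr_ge0//.
  rewrite mulr_ge0 ?(ltW f0)// mulr_ge0 ?(ltW g0)// divr_ge0 ?(ltW gy0)//.
  by rewrite -enorm_sq sqr_ge0.
rewrite grad_proj_fun formZr mulr_ge0 ?divr_ge0 ?(ltW c0)//.
rewrite formDl formNl -enorm_sq.
have thv : vartheta < enorm th.
  rewrite -ltr_sqr ?nnegrE ?enorm_ge0 ?(ltW v0)//.
  by move: f0; rewrite /proj_fun pmulr_lgt0 ?invr_gt0// subr_gt0.
have := form1_CauchySchwarz th_star th; have := enorm_ge0 th_star.
nra.
Qed.

End ProjectionOperator.

(** * Dissipation inequalities for the two parts of Z *)

Section Dissipation.
Context {R : realType} {n : nat}.
Implicit Types (A P Q : 'M[R]_n) (b x d e th y : 'cV[R]_n) (l s m gamma : R).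

Lemma form_lyapunov_eq A P v : P = P^T -> A^T *m P + P *m A = - 1%:M ->
  2 * form P v (A *m v) = - enorm v ^+ 2.
Proof.
move=> Psym /(congr1 (fun M => form M v v)).
rewrite formDm formNm formMl formMr -enorm_sq (form_sym P (A *m v))// => <-.
by ring.
Qed.

(** Expanding Q at s d - l e gives 2 l Q(d,e) <= s Q(d,d) + (l^2/s) Q(e,e). The decay of d absorbs
    the first term, and the upper bound on Q turns the second into the stated constant. *)
Lemma quadratic_dissipation A Q l s m d e : 0 < s ->
  Q^T = Q -> (forall v, 0 <= form Q v v) ->
  (forall v, form Q v v <= m ^+ 2 * enorm v ^+ 2) ->
  2 * form Q d (A *m d) <= - s * form Q d d ->
  2 * form Q d (A *m d + l *: e) <= l ^+ 2 * m ^+ 2 / s * enorm e ^+ 2.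
Proof.
move=> s0 Qsym Q0 Qm QA.
have sq : 2 * s * l * form Q d e <= s ^+ 2 * form Q d d + l ^+ 2 * form Q e e.
  have := Q0 (s *: d - l *: e).
  rewrite formDl !formDr !formNl !formNr !formZl !formZr (form_sym Q e d Qsym); lra.
have Qe := ler_wpM2l (sqr_ge0 l) (Qm e).
rewrite mulrAC ler_pdivlMr// formDr formZr.
have := ler_wpM2r (ltW s0) QA; lra.
Qed.

(** Since x e^T P b is the scalar e^T P b times x, the update law produces exactly the opposite of
    the indefinite term 2 (th . x) e^T P b; only the Lyapunov equation's -|e|^2 remains. *)
Lemma adaptive_error_dissipation A P b x e th y gamma : 0 < gamma ->
  P = P^T -> A^T *m P + P *m A = - 1%:M ->
  form 1%:M th y <= gamma * form 1%:M th (- (x *m e^T *m P *m b)) ->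
  2 * form P e (A *m e + form 1%:M th x *: b) + gamma^-1 * (2 * form 1%:M th y) <=
  - enorm e ^+ 2.
Proof.
move=> g0 Psym PA; have -> : x *m e^T *m P *m b = form P e b *: x.
  rewrite -!mulmxA [e^T *m _]mx11_scalar mul_mx_scalar /form.
  by rewrite mulmxA.
rewrite formNr formZr => hy.
rewrite formDr formZr mulrDr form_lyapunov_eq//.
have : gamma^-1 * form 1%:M th y <= - (form P e b * form 1%:M th x).
  by rewrite mulrC ler_pdivrMr// mulrC.
lra.
Qed.

End Dissipation.

(** * Combining statements that hold almost everywhere *)

Section LebesgueAe.
Context {R : realType} (A B : R -> Prop).
Local Notation ae := (almost_everywhere (@lebesgue_measure R)).

Lemma lebesgue_ae_and :
  {ae @lebesgue_measure R, forall t, A t} ->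
  {ae @lebesgue_measure R, forall t, B t} ->
  {ae @lebesgue_measure R, forall t, A t /\ B t}.
Proof. exact: (@filterI _ ae _ A B). Qed.

Lemma lebesgue_ae_imply : (forall t, A t -> B t) ->
  {ae @lebesgue_measure R, forall t, A t} ->
  {ae @lebesgue_measure R, forall t, B t}.
Proof. by move=> AB; exact: (@filterS _ ae _ A B AB). Qed.

End LebesgueAe.

Theorem theorem9 (R : realType) (n : nat) (Ap Am P : 'M[R]_n)
    (b theta_star : 'cV[R]_n) (r : R -> R)
    (ell gamma theta_star_max eps : R)
    (x xm xmo theta : R -> 'cV[R]_n) :
  (0 < n)%N ->
  hurwitz Am ->
  (exists M : R, forall t : R, 0 <= t -> `|r t| <= M) ->
  0 <= ell -> 0 < gamma -> 0 < theta_star_max -> 0 < eps ->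
  Am = Ap + b *m theta_star^T ->
  enorm theta_star <= theta_star_max ->
  let Am_bar : 'M[R]_n := Am - ell%:M in
  sym_posdef P ->
  Am_bar^T *m P + P *m Am_bar = - 1%:M ->
  let Gamma : 'M[R]_n := gamma%:M in
  let f : 'cV[R]_n -> R := proj_fun theta_star_max eps in
  let theta_max : R := theta_star_max + eps in
  let e : R -> 'cV[R]_n := fun t => x t - xm t in
  let u : R -> R := fun t => ((theta t)^T *m x t) 0 0 + r t in
  solves_ode x (fun t => Ap *m x t + u t *: b) ->
  solves_ode xm (fun t => Am *m xm t + r t *: b + ell *: (x t - xm t)) ->
  solves_ode theta
    (fun t => Proj Gamma (theta t) (- (x t *m (e t)^T *m P *m b)) f) ->
  enorm (theta 0) <= theta_max ->
  solves_ode xmo (fun t => Am *m xmo t + r t *: b) ->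
  xmo 0 = xm 0 ->
  let eo : R -> 'cV[R]_n := fun t => x t - xmo t in
  let sigma : R := stability_margin Am in
  let m : R := overshoot Am in
  let rho : R := gamma / (sigma + ell) in
  let theta_tilde : R -> 'cV[R]_n := fun t => theta t - theta_star in
  let nu : R := m ^+ 2 * enorm (e 0) ^+ 2
                + rho^-1 * enorm (theta_tilde 0) ^+ 2 in
  forall t : R, 0 <= t ->
    enorm (eo t) <= enorm (e t) + Num.sqrt (ell / sigma) * m * Num.sqrt nu.
Proof.
move=> n0 hAm _ l0 g0 v0 eps0 Amb ths Am_bar Ppd lyap Gamma f theta_max e u.
move=> [x_ac dx] [xm_ac dxm] [th_ac dth] _ [xmo_ac dxmo] xmo0 eo s m rho tht nu t t0.
have [Q [Qsym Qge Qm QA]] := hurwitz_quadratic_form Am n0 hAm.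
have s0 : 0 < s := stability_margin_gt0 n0 Am hAm.
have m0 : 0 <= m.
  rewrite /m /overshoot exprn_ge0// addr_ge0// divr_ge0 ?(ltW s0)//.
  by rewrite mulr_ge0// opnorm_ge0.
have Q0 v : 0 <= form Q v v by apply: le_trans (Qge v); exact: sqr_ge0.
(* The coefficient of |e|^2 in the growth bound for D^T Q D, so that kappa V' <= - kappa |e|^2
   cancels it. *)
pose kappa := ell ^+ 2 * m ^+ 2 / s.
have kappa0 : 0 <= kappa by rewrite divr_ge0 ?mulr_ge0 ?sqr_ge0 ?(ltW s0).
have PQ v : (s + 2 * ell) * form P v v <= form Q v v.
  apply: (lyapunov_comparison P Q Am_bar) => //; last by lra.
  - by move=> w; apply: form_lyapunov_eq => //; exact: (proj1 Ppd).
  - move=> w; rewrite /Am_bar mulmxBl formDr formNr mul_scalar_mx formZr.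
    have := QA w; rewrite -/s; lra.
pose D (t : R) := xm t - xmo t.
pose Z (t : R) := form Q (D t) (D t) + kappa * (form P (e t) (e t) +
  gamma^-1 * form 1%:M (tht t) (tht t)).
have entry (y : R -> 'cV[R]_n) : locally_abs_continuous y -> entrywise_abs_cont y.
  by move=> hy i; exact: loc_abs_cont_entry.
have Z_ac : loc_abs_cont Z.
  have eac : entrywise_abs_cont e by apply: entrywise_abs_contB; exact: entry.
  have Dac : entrywise_abs_cont D by apply: entrywise_abs_contB; exact: entry.
  have tac : entrywise_abs_cont tht.
    apply: entrywise_abs_contB; first exact: entry.
    by move=> i; exact: loc_abs_cont_cst.
  apply: loc_abs_contD; first exact: loc_abs_cont_form.
  apply: loc_abs_contM; first exact: loc_abs_cont_cst.
  apply: loc_abs_contD; first exact: loc_abs_cont_form.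
  apply: loc_abs_contM; first exact: loc_abs_cont_cst.
  exact: loc_abs_cont_form.
have Z_der : {ae @lebesgue_measure R, forall t : R, 0 < t ->
    exists2 dZ, is_derive t (1 : R) Z dZ & dZ <= 0}.
  have ae4 := lebesgue_ae_and _ _ (lebesgue_ae_and _ _ dx dxm)
    (lebesgue_ae_and _ _ dth dxmo).
  move: ae4; apply: lebesgue_ae_imply => a [[xa xma] [tha xmoa]] a0.
  move: xa xma tha xmoa => /(_ a0) xa /(_ a0) xma /(_ a0) tha /(_ a0) xmoa.
  (* By the matching condition the plant reads x' = Am x + (tht . x) b + r b, and r cancels against
     the reference model. *)
  have de : is_derive a (1 : R) e
      (Am_bar *m e a + form 1%:M (tht a) (x a) *: b).
    apply: is_derive_subr xa xma _.
    have Amx : Am *m x a = Ap *m x a + form 1%:M theta_star (x a) *: b.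
      rewrite Amb mulmxDl -mulmxA [theta_star^T *m _]mx11_scalar mul_mx_scalar.
      by rewrite /form mulmx1.
    have ua : u a = form 1%:M (theta a) (x a) + r a by rewrite /u /form mulmx1.
    rewrite /Am_bar /e ua mulmxBl mul_scalar_mx mulmxBr Amx formDl formNl.
    move: (Ap *m x a) (Am *m xm a) => p q.
    by apply/colP => i; rewrite !mxE; ring.
  have dD : is_derive a (1 : R) D (Am *m D a + ell *: e a).
    apply: is_derive_subr xma xmoa _.
    rewrite /D mulmxBr /e; move: (Am *m xm a) (Am *m xmo a) => p q.
    by apply/colP => i; rewrite !mxE; ring.
  have dt : is_derive a (1 : R) tht (Proj Gamma (theta a) (- (x a *m (e a)^T *m P *m b)) f).
    have dc : is_derive a (1 : R) (fun=> theta_star) 0 by exact: is_derive_cst.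
    apply: is_derive_subr tha dc _.
    by rewrite subr0.
  have dsym M y dy : M^T = M -> is_derive a (1 : R) y dy ->
      is_derive a (1 : R) (fun t => form M (y t) (y t)) (2 * form M (y a) dy).
    move=> Msym hy; apply: is_derive_eq; first exact: is_derive_form.
    by rewrite (form_sym M dy)//; ring.
  eexists.
    apply: is_deriveD; first exact: dsym dD.
    apply: is_deriveZ; apply: is_deriveD; first by apply: dsym de; rewrite -(proj1 Ppd).
    by apply: is_deriveZ; apply: dsym dt; rewrite trmx1.
  rewrite /GRing.scale /=.
  have h1 := quadratic_dissipation Am Q ell s m (D a) (e a) s0 Qsym Q0 Qm (QA (D a)).
  have h2 := adaptive_error_dissipation Am_bar P b (x a) (e a) (tht a) _ gamma g0 (proj1 Ppd)
    lyap (form1_Proj_le theta_star_max eps gamma (theta a) theta_star _ v0 eps0 g0 ths).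
  have := ler_wpM2l kappa0 h2; move: h1; rewrite -/kappa; lra.
have Zt : Z t <= Z 0 := loc_abs_cont_nonincreasing Z Z_ac Z_der t t0.
have P0 v : 0 <= form P v v := form_ge0_of_posdef P v Ppd.
have Dt : enorm (D t) ^+ 2 <= ell / s * m ^+ 2 * nu.
  apply: le_trans (Qge (D t)) _; apply: (@le_trans _ _ (Z t)).
    rewrite lerDl mulr_ge0// addr_ge0// mulr_ge0 ?invr_ge0 ?(ltW g0)//.
    by rewrite -enorm_sq sqr_ge0.
  apply: le_trans Zt _.
  rewrite /Z /D xmo0 subrr [form Q 0 0]/form mulmx0 mxE add0r -enorm_sq /nu /rho invf_div.
  rewrite /kappa; have -> : ell ^+ 2 * m ^+ 2 / s = ell / s * m ^+ 2 * ell by ring.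
  rewrite -(mulrA (ell / s * m ^+ 2)) ler_wpM2l ?(mulr_ge0, sqr_ge0, invr_ge0) ?(ltW s0)//.
  (* It remains that ell V(0) <= nu, term by term: ell P <= (s + 2 ell) P <= Q <= m^2 |.|^2 at e(0),
     and ell / gamma <= (s + ell) / gamma = 1 / rho. *)
  rewrite mulrDr lerD//.
    have := PQ (e 0); have := Qm (e 0); have := P0 (e 0); rewrite -/m; nra.
  rewrite mulrA ler_wpM2r ?sqr_ge0// ler_wpM2r ?invr_ge0 ?(ltW g0)//.
  by rewrite lerDr ltW.
have nu0 : 0 <= nu.
  apply: addr_ge0; first by apply: mulr_ge0; exact: sqr_ge0.
  apply: mulr_ge0; last exact: sqr_ge0.
  by rewrite /rho invf_div; apply: divr_ge0; [exact: addr_ge0 (ltW s0) l0|exact: ltW].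
have -> : eo t = e t + D t by rewrite /eo /e /D addrA subrK.
apply: le_trans (enormD _ _) _; rewrite lerD2l.
apply: enorm_le_sqr; first by rewrite !mulr_ge0 ?sqrtr_ge0.
have ls0 : 0 <= ell / s by exact: divr_ge0 l0 (ltW s0).
by rewrite 2!exprMn (sqr_sqrtr nu0) (sqr_sqrtr ls0).
Qed.
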